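(* Let $x_e\in\mathbb{R}^n$ and assume that $\mathcal{B}(x_e)=\emptyset$, equivalently $0\notin V(x_e)$. Let $v^\star$ be the unique element of minimal Euclidean norm of the compact convex set $V(x_e)$, and set $\alpha:=\|v^\star\|>0$, $\lambda:=v^\star/\|v^\star\|$ and $\Phi(x):=\langle\lambda,x\rangle$ for $x\in\mathbb{R}^n$. Then there exist $\rho>0$ and $\alpha'\in(0,\alpha]$ with $\inf_{v\in V(x)}\langle\lambda,v\rangle\ge\alpha'$ for all $x\in B_\rho(x_e)$, and for such $\rho,\alpha'$ the following hold. (i) Every admissible trajectory $x(\cdot)$ that remains in $B_\rho(x_e)$ satisfies, for almost every $t$, $$\frac{d}{dt}\Phi(x(t))=\langle\lambda,\dot x(t)\rangle\ge\alpha'>0 .$$ (ii) Consequently, for every admissible trajectory and all $t$ such that $x([0,t])\subset B_\rho(x_e)$, $$\Phi(x(t))\ge\Phi(x(0))+\alpha' t .$$ (iii) No point $y$ with $\Phi(y)<\Phi(x_e)$ can be reached from $x_e$ by an admissible trajectory remaining in $B_\rho(x_e)$. Therefore the system $(\mathcal{F},\Omega)$ is not small-time locally controllable (STLC) at $x_e$.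
   Context: Setting. Let $\mathcal{F}=\{f_0,g_1,\dots,g_m\}$ be vector fields on $\mathbb{R}^n$ of class $C^\nu$, $\nu\in\mathbb{Z}_{\ge1}\cup\{\infty,\omega\}$. The system $(\mathcal{F},\Omega)$ is $$\dot x(t)=f_0(x(t))+\sum_{i=1}^m u_i(t)g_i(x(t)),\qquad u(t)\in\Omega(x(t)),\qquad \Omega(x)=\prod_{i=1}^m[\underline u_i(x),\overline u_i(x)]\subset\mathbb{R}^m .$$ Standing assumptions: the functions $\underline u_i,\overline u_i:\mathbb{R}^n\to\mathbb{R}$ are continuous with $\underline u_i(x)<\overline u_i(x)$ for all $x,i$; and zero is excluded: either $0<\underline u_i(x)$ for all $x,i$, or $\overline u_i(x)<0$ for all $x,i$. Feasible velocity set: $V(x):=\{f_0(x)+\sum_{i=1}^m u_ig_i(x):u\in\Omega(x)\}$. Admissible balancing set: $\mathcal{B}(x_e):=\{u\in\Omega(x_e): f_0(x_e)+\sum_{i=1}^m u_ig_i(x_e)=0\}$. Admissible trajectory: an absolutely continuous map $x:[0,T]\to\mathbb{R}^n$ ($T>0$) for which there is $u\in L^\infty(0,T;\mathbb{R}^m)$ with $u(t)\in\Omega(x(t))$ and $\dot x(t)=f_0(x(t))+\sum_i u_i(t)g_i(x(t))$ for a.e. $t\in(0,T)$. Reachable set: for an open neighborhood $\mathcal{N}$ of $x_e$ and $T>0$, $\mathcal{R}_{\mathcal{F}}^\Omega(\le T,x_e;\mathcal{N})$ is the union of $\{x_e\}$ and the set of all $x(\tau)$ with $0<\tau\le T$ and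 $x:[0,\tau]\to\mathcal{N}$ an admissible trajectory with $x(0)=x_e$. STLC: $(\mathcal{F},\Omega)$ is STLC at $x_e$ if there is an open neighborhood $\mathcal{N}$ of $x_e$ such that for every $\varepsilon>0$ there is $r(\varepsilon)>0$ with $B_{r(\varepsilon)}(x_e)\subseteq\mathcal{R}_{\mathcal{F}}^\Omega(\le\varepsilon,x_e;\mathcal{N})$. $\|\cdot\|$ and $\langle\cdot,\cdot\rangle$ are the Euclidean norm and inner product on $\mathbb{R}^n$, and $B_r(x_e)$ is the open Euclidean ball. *)

(* Defs.v *)
(* R^n is 'rV[R]_n.  The library norm `|x| on
   'rV[R]_n is the sup norm: it gives the usual topology (used for open,
   compact, continuous, derivatives), while every metric quantity below uses the
   Euclidean norm enorm. *)
From mathcomp Require Import all_boot all_order all_algebra.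
From mathcomp Require Import finmap.
From mathcomp Require Import all_classical all_reals all_analysis.
From mathcomp.analysis.showcase Require summability.

Set Implicit Arguments.
Unset Strict Implicit.
Unset Printing Implicit Defensive.

Import Order.TTheory GRing.Theory Num.Theory.
Import numFieldNormedType.Exports.

Local Open Scope classical_set_scope.
Local Open Scope ring_scope.

Section Euclidean.
Context {R : realType} {n : nat}.
Implicit Types x y : 'rV[R]_n.

Definition dot x y : R := \sum_(i < n) x 0 i * y 0 i.

Definition enorm x : R := Num.sqrt (dot x x).

Definition eball x (r : R) : set 'rV[R]_n := [set y | enorm (y - x) < r].

Definition min_norm_elt (A : set 'rV[R]_n) x : Prop :=
  A x /\ forall y, A y -> enorm x <= enorm y.

End Euclidean.

Section Smoothness.
Context {R : realType} {n p : nat}.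

(* All iterated partial derivatives of order <= k exist everywhere and are
   continuous. *)
Fixpoint class_C (k : nat) (f : 'rV[R]_n -> 'rV[R]_p) : Prop :=
  continuous f /\
  if k is k'.+1 then
    forall i : 'I_n, (forall x, derivable f x (delta_mx 0 i)) /\
                     class_C k' (fun x => 'D_(delta_mx 0 i) f x)
  else True.

Definition monomial (a : {ffun 'I_n -> nat}) (h : 'rV[R]_n) : R :=
  \prod_(i < n) h 0 i ^+ a i.

(* Near every point, each component is the sum of a multivariate power series.
   The sum over multi-indices is the unconditional one: the limit of the finite
   partial sums along the directed set of finite sets of multi-indices. *)
Definition analytic (f : 'rV[R]_n -> 'rV[R]_p) : Prop :=
  forall (j : 'I_p) (x0 : 'rV[R]_n),
  exists (r : R) (c : {ffun 'I_n -> nat} -> R), 0 < r /\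
  forall x, eball x0 r x ->
    summability.partial_sum (fun a => c a * monomial a (x - x0))
      @ summability.totally --> f x 0 j.

End Smoothness.

Inductive smoothness : Type :=
| Cfinite (k : nat) of (1 <= k)%N
| Cinfty
| Comega.

Definition of_class {R : realType} {n p : nat} (nu : smoothness)
    (f : 'rV[R]_n -> 'rV[R]_p) : Prop :=
  match nu with
  | Cfinite k _ => class_C k f
  | Cinfty => forall k, class_C k f
  | Comega => analytic f
  end.

Section TimeFunctions.
Context {R : realType}.

Definition abs_continuous {n : nat} (a b : R) (x : R -> 'rV[R]_n) : Prop :=
  forall e : R, 0 < e -> exists2 d : R, 0 < d &
  forall (N : nat) (s t : 'I_N -> R),
    (forall k, [/\ a <= s k, s k <= t k & t k <= b]) ->
    trivIset setT (fun k => `]s k, t k[%classic) ->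
    \sum_(k < N) (t k - s k) < d ->
    \sum_(k < N) enorm (x (t k) - x (s k)) < e.

(* L^oo(0,T; R^m), componentwise: the extension by 0 of u|_(0,T) is in
   L^oo(R).  Every class of Lebesgue measurable functions modulo a.e. equality
   has a Borel measurable representative, so Borel measurability (the one on R
   in the library) loses nothing. *)
Definition Linfty {m : nat} (T : R) (u : R -> 'rV[R]_m) : Prop :=
  forall i : 'I_m,
    (fun t => u t 0 i) \_ (`]0, T[%classic) \in Lfun (@lebesgue_measure R) +oo%E.

End TimeFunctions.

(* ulo i, uhi i are the i-th lower and upper control bounds. *)
Record box_system (R : realType) (n m : nat) := BoxSystem {
  drift : 'rV[R]_n -> 'rV[R]_n;
  ctrl  : 'I_m -> 'rV[R]_n -> 'rV[R]_n;
  ulo   : 'I_m -> 'rV[R]_n -> R;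
  uhi   : 'I_m -> 'rV[R]_n -> R }.

Section ControlSystem.
Context {R : realType} {n m : nat} (F : box_system R n m).
Implicit Types (x y : 'rV[R]_n) (u : 'rV[R]_m).

Definition Omega x : set 'rV[R]_m :=
  [set u | forall i, ulo F i x <= u 0 i <= uhi F i x].

Definition velocity x u : 'rV[R]_n :=
  drift F x + \sum_(i < m) u 0 i *: ctrl F i x.

Definition feasible_velocities x : set 'rV[R]_n :=
  [set velocity x u | u in Omega x].

Definition balancing_set x : set 'rV[R]_m :=
  [set u | Omega x u /\ velocity x u = 0].

(* A curve on [0,T] is a total function R -> R^n of which only the values on
   [0,T] matter. *)
Definition admissible (T : R) (x : R -> 'rV[R]_n) : Prop :=
  [/\ 0 < T, abs_continuous 0 T x &
   exists u : R -> 'rV[R]_m, Linfty T u /\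
     {ae lebesgue_measure, forall t : R, t \in `]0, T[ ->
        Omega (x t) (u t) /\ is_derive t 1 x (velocity (x t) (u t))}].

Definition stays_in (T : R) (x : R -> 'rV[R]_n) (N : set 'rV[R]_n) : Prop :=
  forall t : R, t \in `[0, T] -> N (x t).

Definition reachable (T : R) x0 (N : set 'rV[R]_n) : set 'rV[R]_n :=
  [set x0] `|`
  [set y | exists (tau : R) (x : R -> 'rV[R]_n),
     [/\ 0 < tau <= T, admissible tau x, stays_in tau x N,
         x 0 = x0 & x tau = y]].

Definition STLC x0 : Prop :=
  exists N : set 'rV[R]_n, [/\ open N, N x0 &
    forall e : R, 0 < e -> exists2 r : R, 0 < r &
      eball x0 r `<=` reachable e x0 N].

End ControlSystem.

(* Main.v *)
(* Write lambda = v*/|v*|.  Convexity of V(x_e) gives <lambda, v> >= alpha on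
   V(x_e); the minimum of <lambda, .> over V(x) is attained at a vertex of the
   control box, hence is continuous in x and stays above alpha/2 near x_e.  So
   Phi increases along trajectories near x_e, at an a.e. rate bounded below, and
   absolute continuity turns the rate into an increment.  A trajectory needs a
   positive time to leave a ball on which velocities are bounded, so in small
   time no point x_e - s lambda with s > 0 is reached.

   No integration is needed: if an absolutely continuous g is locally increasing
   off a null set E, put E inside an open set U of small measure and climb from
   a to b.  Passing a point of E costs at most the increment of g over an
   interval inside U, these intervals are disjoint, and by absolute continuity
   their increments have a small sum. *)
Require Import Defs.
From mathcomp Require Import all_boot all_order all_algebra.
From mathcomp Require Import finmap.
From mathcomp Require Import all_classical all_reals all_analysis.
From mathcomp.analysis.showcase Require summability.
From mathcomp Require Import ring lra.

Set Implicit Arguments.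
Unset Strict Implicit.
Unset Printing Implicit Defensive.

Import Order.TTheory GRing.Theory Num.Theory.
Import numFieldNormedType.Exports.

Local Open Scope classical_set_scope.
Local Open Scope ring_scope.

(** * Euclidean inner product and norm, compared with the sup-norm topology *)

Section EuclideanTheory.
Context {R : realType} {n : nat}.
Implicit Types (x y z : 'rV[R]_n) (a : R).

Lemma dotC x y : dot x y = dot y x.
Proof. by apply: eq_bigr => i _; rewrite mulrC. Qed.

Lemma dotDr x y z : dot x (y + z) = dot x y + dot x z.
Proof. by rewrite -big_split; apply: eq_bigr => i _; rewrite mxE mulrDr. Qed.

Lemma dotZr a x y : dot x (a *: y) = a * dot x y.
Proof. by rewrite mulr_sumr; apply: eq_bigr => i _; rewrite mxE mulrCA. Qed.

Lemma dotNr x y : dot x (- y) = - dot x y.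
Proof. by rewrite -scaleN1r dotZr mulN1r. Qed.

Lemma dotBr x y z : dot x (y - z) = dot x y - dot x z.
Proof. by rewrite dotDr dotNr. Qed.

Lemma dotDl x y z : dot (x + y) z = dot x z + dot y z.
Proof. by rewrite dotC dotDr !(dotC z). Qed.

Lemma dotZl a x y : dot (a *: x) y = a * dot x y.
Proof. by rewrite dotC dotZr dotC. Qed.

Lemma dotNl x y : dot (- x) y = - dot x y.
Proof. by rewrite dotC dotNr dotC. Qed.

Lemma dotBl x y z : dot (x - y) z = dot x z - dot y z.
Proof. by rewrite dotDl dotNl. Qed.

Lemma dot_sumr (I : Type) (r : seq I) (P : pred I) x (F : I -> 'rV[R]_n) :
  dot x (\sum_(i <- r | P i) F i) = \sum_(i <- r | P i) dot x (F i).
Proof.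
apply: (big_morph (dot x)) => [y z|]; first exact: dotDr.
by rewrite -(scale0r x) dotZr mul0r.
Qed.

Lemma dotxx_ge0 x : 0 <= dot x x.
Proof. by apply: sumr_ge0 => i _; rewrite -expr2 sqr_ge0. Qed.

Lemma dotxx_eq0 x : (dot x x == 0) = (x == 0).
Proof.
apply/idP/eqP => [|->]; last by rewrite -(scale0r (0 : 'rV_n)) dotZr mul0r.
rewrite psumr_eq0 => [/allP x0|i _]; last by rewrite -expr2 sqr_ge0.
apply/rowP => i; rewrite mxE; apply/eqP.
by have := x0 i (mem_index_enum i); rewrite mulf_eq0 orbb.
Qed.

Lemma sqr_enorm x : enorm x ^+ 2 = dot x x.
Proof. by rewrite sqr_sqrtr ?dotxx_ge0. Qed.

Lemma enorm_ge0 x : 0 <= enorm x.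
Proof. exact: sqrtr_ge0. Qed.

Lemma enorm_eq0 x : (enorm x == 0) = (x == 0).
Proof. by rewrite -dotxx_eq0 -sqr_enorm sqrf_eq0. Qed.

Lemma enorm_gt0 x : (0 < enorm x) = (x != 0).
Proof. by rewrite lt0r enorm_ge0 andbT enorm_eq0. Qed.

Lemma enorm0 : enorm (0 : 'rV[R]_n) = 0.
Proof. by apply/eqP; rewrite enorm_eq0. Qed.

Lemma enormZ a x : enorm (a *: x) = `|a| * enorm x.
Proof.
by rewrite /enorm dotZl dotZr mulrA -expr2 sqrtrM ?sqr_ge0// sqrtr_sqr.
Qed.

Lemma enormN x : enorm (- x) = enorm x.
Proof. by rewrite -scaleN1r enormZ normrN1 mul1r. Qed.

Lemma enormB x y : enorm (x - y) = enorm (y - x).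
Proof. by rewrite -enormN opprB. Qed.

(** Expands the square norm of <y,y> x - <x,y> y, which is <y,y> (<x,x><y,y> - <x,y>^2), and cancels
    the positive factor <y,y>. *)
Lemma cauchy_schwarz x y : dot x y <= enorm x * enorm y.
Proof.
have [->|y0] := eqVneq y 0.
  by rewrite -(scale0r 0) dotZr enormZ !(mul0r, normr0, mulr0).
rewrite (le_trans (ler_norm _))// -sqrtr_sqr -sqrtrM ?dotxx_ge0//.
rewrite ler_wsqrtr//.
have yy0 : 0 < dot y y by rewrite lt0r dotxx_eq0 y0 dotxx_ge0.
have := dotxx_ge0 (dot y y *: x - dot x y *: y).
rewrite !(dotBl, dotBr, dotZl, dotZr) (dotC y x).
set p := dot x x; set q := dot y y; set s := dot x y => H.
have {}H : 0 <= q * (p * q - s ^+ 2).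
  by rewrite (le_trans H)// le_eqVlt; apply/orP; left; apply/eqP; ring.
by rewrite -subr_ge0 -(pmulr_rge0 _ yy0).
Qed.

Lemma cauchy_schwarz_norm x y : `|dot x y| <= enorm x * enorm y.
Proof.
by rewrite ler_norml lerNl -dotNl -{1}(enormN x) !cauchy_schwarz.
Qed.

Lemma enormD x y : enorm (x + y) <= enorm x + enorm y.
Proof.
rewrite -ler_sqr ?nnegrE ?addr_ge0 ?enorm_ge0// sqrrD !sqr_enorm.
rewrite dotDl !dotDr (dotC y x).
have := cauchy_schwarz x y; lra.
Qed.

Lemma enorm_sum (I : Type) (r : seq I) (P : pred I) (F : I -> 'rV[R]_n) :
  enorm (\sum_(i <- r | P i) F i) <= \sum_(i <- r | P i) enorm (F i).
Proof.
elim/big_rec2 : _ => [|i a v _ ih]; first by rewrite enorm0.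
by rewrite (le_trans (enormD _ _))// lerD2l.
Qed.

Lemma coord_le_enorm x i : `|x 0 i| <= enorm x.
Proof.
rewrite -sqrtr_sqr ler_wsqrtr// /dot (bigD1 i)//= -expr2 lerDl.
by apply: sumr_ge0 => j _; rewrite -expr2 sqr_ge0.
Qed.

Lemma norm_le_enorm x : `|x| <= enorm x.
Proof.
rewrite /Num.Def.normr/= mx_normrE; apply: bigmax_le => [|[i j] _] /=.
  exact: enorm_ge0.
by rewrite ord1 coord_le_enorm.
Qed.

Lemma cvg_dot (T : Type) (G : set_system T) (f g : T -> 'rV[R]_n) x y :
  Filter G -> f @ G --> x -> g @ G --> y ->
  (fun t => dot (f t) (g t)) @ G --> dot x y.
Proof.
move=> FG fx gy; rewrite /dot.
apply: (cvg_big add_continuous) => i _; apply: cvgM.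
  exact: (cvg_comp _ _ fx (@coord_continuous _ _ _ 0 i x)).
exact: (cvg_comp _ _ gy (@coord_continuous _ _ _ 0 i y)).
Qed.

Lemma enorm_continuous : continuous (@enorm R n).
Proof.
move=> x; apply: (@continuous_comp _ _ _ (fun x => dot x x)).
  exact: (@cvg_dot _ (nbhs x) id id x x (nbhs_filter x) cvg_id cvg_id).
exact: sqrt_continuous.
Qed.

Lemma nbhs_eball x r : 0 < r -> \forall y \near x, eball x r y.
Proof.
move=> r0; have : enorm (y - x) @[y --> x] --> enorm (x - x).
  have H : (fun y => y - x) @ nbhs x --> x - x.
    exact: (cvgB cvg_id (cvg_cst x)).
  exact: (cvg_comp _ _ H (enorm_continuous (x := _))).
by rewrite subrr enorm0 => /cvgr_lt; exact.
Qed.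

(** The sup norm is at most the Euclidean norm, so a Euclidean ball lies in the sup-norm ball of the
    same radius. *)
Lemma nbhs_eballP x (P : set 'rV[R]_n) :
  nbhs x P -> exists2 r : R, 0 < r & eball x r `<=` P.
Proof.
move=> /nbhs_ballP[r /= r0 rP]; exists r => // y xy; apply: rP.
by rewrite -ball_normE /= distrC (le_lt_trans (norm_le_enorm _)).
Qed.

End EuclideanTheory.

(** * Monotonicity of absolutely continuous functions, by climbing *)

Section AbsoluteContinuity.
Context {R : realType}.
Local Notation mu := (@lebesgue_measure R).
Implicit Types (a b c t : R) (g : R -> R) (E U : set R).

Definition scalar_ac a b g : Prop :=
  forall e : R, 0 < e -> exists2 d : R, 0 < d &
  forall (N : nat) (s t : 'I_N -> R),
    (forall k, [/\ a <= s k, s k <= t k & t k <= b]) ->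
    trivIset setT (fun k => `]s k, t k[%classic) ->
    \sum_(k < N) (t k - s k) < d ->
    \sum_(k < N) `|g (t k) - g (s k)| < e.

(** Nearby values are compared with [g t] alone, not with each other: this is what a derivative
    bound at the single point [t] can give. *)
Definition increasing_at g t : Prop :=
  \forall s \near t, (s <= t -> g s <= g t) /\ (t <= s -> g t <= g s).

(* The drop of g from a to t is paid for by finitely many disjoint intervals
   contained in U. *)
Definition covered_descent U a g t : Prop :=
  exists (N : nat) (s u : 'I_N -> R),
    [/\ forall k, [/\ a <= s k, s k <= u k & u k <= t],
        trivIset setT (fun k => `]s k, u k[%classic),
        forall k, `]s k, u k[%classic `<=` U &
        g a - g t <= \sum_(k < N) `|g (u k) - g (s k)|].

Lemma covered_descent_ge U a g t t' :
  t <= t' -> g t <= g t' -> covered_descent U a g t -> covered_descent U a g t'.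
Proof.
move=> tt' gtt' [N [s [u [su dis sU h]]]]; exists N, s, u; split => //.
  by move=> k; have [? ? ?] := su k; split => //; exact: le_trans tt'.
by rewrite (le_trans _ h)// lerD2l lerN2.
Qed.

(** The interval from [t] to [t'] joins the family as its last member: the earlier ones end by [t],
    so disjointness persists, and its own increment pays for any drop of [g] from [t] to [t']. *)
Lemma covered_descent_sub U a g t t' :
  a <= t -> t <= t' -> `]t, t'[%classic `<=` U ->
  covered_descent U a g t -> covered_descent U a g t'.
Proof.
move=> at_ tt' ttU [N [s [u [su dis sU h]]]].
pose s' := fun k : 'I_N.+1 => oapp s t (unlift ord_max k).
pose u' := fun k : 'I_N.+1 => oapp u t' (unlift ord_max k).
exists N.+1, s', u'; split.
- move=> k; rewrite /s' /u'; case: (unliftP ord_max k) => [j _|_] /=.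
    by have [? ? ?] := su j; split => //; exact: le_trans tt'.
  by split.
- move=> i j _ _; rewrite /s' /u'.
  case: (unliftP ord_max i) => [i' ->|->] /=;
    case: (unliftP ord_max j) => [j' ->|->] //= [x []] /=; rewrite !in_itv /=.
  + move=> xi xj; congr lift; apply: dis => //.
    by exists x; split; rewrite /= in_itv.
  + move=> /andP[_ xu] /andP[tx _]; have [_ _ ut] := su i'.
    by have := lt_trans tx (lt_le_trans xu ut); rewrite ltxx.
  + move=> /andP[tx _] /andP[_ xu]; have [_ _ ut] := su j'.
    by have := lt_trans tx (lt_le_trans xu ut); rewrite ltxx.
- move=> k; rewrite /s' /u'; case: (unliftP ord_max k) => [j _|_] //=.
- rewrite big_ord_recr /= /s' /u' unlift_none /=.
  rewrite (eq_bigr (fun k => `|g (u k) - g (s k)|)); last first.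
    move=> k _.
    have -> : widen_ord (leqnSn N) k = lift ord_max k.
      by apply: val_inj; rewrite /= /bump leqNgt ltn_ord.
    by rewrite liftK.
  have := ler_norm (g t - g t'); rewrite distrC; lra.
Qed.

(** Additivity over the disjoint intervals, then monotonicity of the measure. *)
Lemma sum_itv_le_measure U N (s t : 'I_N -> R) :
  open U -> (forall k, s k <= t k) ->
  trivIset setT (fun k => `]s k, t k[%classic) ->
  (forall k, `]s k, t k[%classic `<=` U) ->
  ((\sum_(k < N) (t k - s k))%:E <= mu U)%E.
Proof.
move=> oU st dis sU; rewrite -sumEFin.
rewrite (eq_bigr (fun k => mu `]s k, t k[%classic)); last first.
  move=> k _; rewrite lebesgue_measure_itv /= lte_fin.
  case: ltgtP (st k) => // -> _; by rewrite subrr.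
rewrite -measure_bigsetU_ord//.
apply: le_measure; rewrite ?inE.
- by apply: bigsetU_measurable => k _; exact: measurable_itv.
- exact: measurable_realfun.open_measurable.
- by elim/big_ind : _ => // A B AU BU x []; [exact: AU|exact: BU].
Qed.

Lemma increasing_ae_le a b g E :
  a <= b -> scalar_ac a b g -> mu.-negligible E ->
  (forall t, a < t < b -> ~ E t -> increasing_at g t) -> g a <= g b.
Proof.
move=> ab acg nE inc.
(* The endpoints are put into the null set, since [inc] says nothing about them. *)
have n1 t : mu.-negligible [set t].
  apply/negligibleP; first exact: measurable_set1.
  exact: lebesgue_measure_set1.
have [A [mA A0 EA]] := negligibleU nE (negligibleU (n1 a) (n1 b)).
apply/ler_addgt0Pr => e e0; have [d d0 acd] := acg e e0.
have [U [oU AU mU]] : exists U : set R, [/\ open U, A `<=` U & (mu U < d%:E)%E].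
  have [|U [oU AU UA]] := lebesgue_regularity_outer mA _ d0.
    by rewrite A0 ltry.
  exists U; split => //; rewrite -(setDUK AU).
  have mUA : measurable (U `\` A).
    by apply: measurableD => //; exact: measurable_realfun.open_measurable.
  have := measureU2 mu mA mUA.
  by rewrite A0 add0e => /le_lt_trans; exact.
pose S := [set t | a <= t <= b /\ covered_descent U a g t].
have Sa : S a.
  split; first by rewrite lexx.
  exists 0%N, (fun=> 0), (fun=> 0); split; do ?by case.
  by rewrite big_ord0 subrr.
have ubS : ubound S b by move=> t [/andP[]].
have hsS : has_sup S by split; [exists a|exists b].
set c := sup S.
have ac : a <= c by apply: ub_le_sup => //; exists b.
have cb : c <= b by apply: ge_sup => //; exists a.
(* [S] propagates across its supremum [c]. If [c] is in [A], an interval around [c] lies in [U] and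
   is added to the family; otherwise [g] is increasing at [c] and the crossing is free. *)
have [r r0 jump] : exists2 r : R, 0 < r &
    forall t t', S t -> c - r < t -> t <= c -> c <= t' -> t' < c + r ->
      t' <= b -> S t'.
  have [cA|cA] := pselect (A c).
    have : nbhs c U by apply: open_nbhs_nbhs; split => //; exact: AU.
    move=> /nbhs_ballP[r /= r0 rU]; exists r => // t t' [/andP[at_ tb] Pt] ? ? ? ? ?.
    split; first lra.
    apply: covered_descent_sub Pt => //; first lra.
    move=> x /=; rewrite in_itv /= => /andP[tx xt']; apply: rU.
    by rewrite -ball_normE /= ltr_norml; lra.
  have acb : a < c < b.
    by rewrite !lt_neqAle ac cb !andbT; apply/andP; split;
      apply/eqP => ce; apply: cA; apply: EA; right; [left|right].
  have /nbhs_ballP[r /= r0 rI] : increasing_at g c.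
    by apply: inc => // Ec; apply: cA; apply: EA; left.
  exists r => // t t' [/andP[at_ tb] Pt] ct tc ct' t'c t'b.
  split; first lra.
  have gct' : g c <= g t'.
    by apply: (rI t' _).2 => //; rewrite -ball_normE /= ltr_norml; lra.
  have gtc : g t <= g c.
    by apply: (rI t _).1 => //; rewrite -ball_normE /= ltr_norml; lra.
  exact: covered_descent_ge ct' gct' (covered_descent_ge tc gtc Pt).
have Sb : S b.
  have [t St ct] := sup_adherent r0 hsS.
  have tc : t <= c by apply: ub_le_sup => //; exists b.
  (* Either the jump reaches [b], or it puts a point of [S] beyond [sup S]. *)
  have [cbr|cbr] := leP b (c + r / 2).
    by apply: (jump t) => //; lra.
  have : S (c + r / 2) by apply: (jump t) => //; lra.
  by move=> /(ub_le_sup _) => /(_ (ex_intro _ b ubS)); rewrite -/c; lra.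
have [_ [N [s [u [su dis sU h]]]]] := Sb.
rewrite -lerBlDl (le_trans h)// ltW//; apply: acd => //.
rewrite -lte_fin (le_lt_trans _ mU)//; apply: sum_itv_le_measure => //.
by move=> k; have [] := su k.
Qed.

End AbsoluteContinuity.

(** * From almost everywhere derivative bounds to increments *)

Section DerivativeBounds.
Context {R : realType}.
Local Notation mu := (@lebesgue_measure R).

(** Because the inequality is strict, the difference quotients themselves exceed [c] near [t];
    multiplying by [s - t] gives one comparison on each side. *)
Lemma increasing_at_slope (g : R -> R) (c t : R) :
  derivable g t 1 -> c < derive1 g t -> increasing_at (fun s => g s - c * s) t.
Proof.
rewrite derive1E /derivable /derive => dg /(cvgr_gt _ dg) /nbhs_ballP[r /= r0 slope].
apply/nbhs_ballP; exists r => //= s; rewrite -ball_normE /= => ts.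
have [->|st] := eqVneq s t; first by [].
have : c < (s - t)^-1 * (g s - g t).
  have := slope (s - t); rewrite -ball_normE /= sub0r normrN distrC subr_eq0.
  by move=> /(_ ts st); rewrite /= scaler1 subrK.
rewrite mulrC.
have [lt_st|lt_ts|/eqP] := ltgtP s t; last by rewrite (negPf st).
- rewrite ltr_ndivlMr ?subr_lt0//; split; lra.
- rewrite ltr_pdivlMr ?subr_gt0//; split; lra.
Qed.

(** Lowering the slope to [c - eta] makes the bound strict, so subtracting the corresponding linear
    function leaves a function that is increasing at almost every point. The loss [eta * (b - a)] is
    arbitrarily small. *)
Lemma ac_slope_le (g : R -> R) (a b c : R) :
  a <= b -> scalar_ac a b g ->
  {ae mu, forall t, t \in `]a, b[ -> derivable g t 1 /\ c <= derive1 g t} ->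
  c * (b - a) <= g b - g a.
Proof.
move=> ab acg dg; apply/ler_addgt0Pr => e e0.
have [eta eta0 etab] : exists2 eta : R, 0 < eta & eta * (b - a) <= e.
  have ba1 : 0 < b - a + 1 by lra.
  exists (e / (b - a + 1)); first exact: divr_gt0.
  by rewrite mulrAC ler_pdivrMr// ler_wpM2l//; lra.
pose k := c - eta.
suff : g a - k * a <= g b - k * b by rewrite /k; lra.
have sub_ac : scalar_ac a b (fun t => g t - k * t).
  move=> d d0; have [d1 d10 gd1] := acg (d / 2) (divr_gt0 d0 (ltr0Sn _ _)).
  have k1 : 0 < 2 * (`|k| + 1) by rewrite mulr_gt0 ?ltr_pwDr ?normr_ge0.
  (* The linear term varies by |k| times the total length, at most [d / 2]; the added 1 covers
     [k = 0]. *)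
  exists (Num.min d1 (d / (2 * (`|k| + 1)))).
    by rewrite lt_min d10 divr_gt0.
  move=> N s t st dis; rewrite lt_min => /andP[sd1 sd].
  apply: (@le_lt_trans _ _ (\sum_(i < N) (`|g (t i) - g (s i)| +
    `|k| * (t i - s i)))).
    apply: ler_sum => i _; have [_ sti _] := st i.
    have -> : g (t i) - k * t i - (g (s i) - k * s i) =
      (g (t i) - g (s i)) - k * (t i - s i) by ring.
    rewrite (le_trans (ler_normB _ _))// lerD2l normrM.
    by rewrite (@ger0_norm _ (t i - s i)) ?subr_ge0.
  rewrite big_split /= -mulr_sumr.
  have := gd1 _ _ _ st dis sd1.
  have S0 : 0 <= \sum_(i < N) (t i - s i).
    by apply: sumr_ge0 => i _; have [_ ? _] := st i; rewrite subr_ge0.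
  move: sd; rewrite ltr_pdivlMr//; move: S0.
  set S := \sum_(i < N) (t i - s i) => S0 Sd.
  have : `|k| * S <= d / 2 by lra.
  lra.
apply: (increasing_ae_le ab sub_ac dg) => t tab /contrapT dgt.
have [|dt ct] := dgt; first by rewrite in_itv.
by apply: increasing_at_slope => //; rewrite /k; lra.
Qed.

Lemma dot_scalar_ac n (w : 'rV[R]_n) (x : R -> 'rV[R]_n) (a b b' : R) :
  b' <= b -> abs_continuous a b x -> scalar_ac a b' (fun t => dot w (x t)).
Proof.
move=> b'b acx e e0; have w1 : 0 < enorm w + 1 by rewrite ltr_pwDr ?enorm_ge0.
have [d d0 xd] := acx (e / (enorm w + 1)) (divr_gt0 e0 w1).
exists d => // N s t st dis std.
have st' k : [/\ a <= s k, s k <= t k & t k <= b].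
  by have [? ? ?] := st k; split => //; exact: le_trans b'b.
have := xd _ _ _ st' dis std; rewrite ltr_pdivlMr//; apply: le_lt_trans.
rewrite mulr_suml; apply: ler_sum => k _.
rewrite -dotBr (le_trans (cauchy_schwarz_norm _ _))// mulrC.
by rewrite ler_wpM2l ?enorm_ge0// lerDl.
Qed.

Lemma derive1_dot n (w : 'rV[R]_n) (x : R -> 'rV[R]_n) (t : R) :
  derivable x t 1 ->
  derivable (fun s => dot w (x s)) t 1 /\
  derive1 (fun s => dot w (x s)) t = dot w (derive1 x t).
Proof.
rewrite !derive1E => dx.
suff H : (h^-1 *: (dot w (x (h *: (1 : R) + t)) - dot w (x t))
    @[h --> 0^']) --> dot w ('D_1 x t).
  by split; [apply/cvg_ex; eexists; exact: H|exact/cvg_lim].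
rewrite (_ : (fun h => _) =
    fun h : R => dot w (h^-1 *: (x (h *: (1 : R) + t) - x t))); last first.
  by apply/funext => h; rewrite dotZr dotBr.
by apply: cvg_dot; [exact: cvg_cst|exact: dx].
Qed.

Lemma ae_impl (P Q : R -> Prop) :
  (forall t, P t -> Q t) ->
  {ae mu, forall t, P t} -> {ae mu, forall t, Q t}.
Proof. by move=> PQ; apply: negligibleS => t; apply: contra_not; exact: PQ. Qed.

Lemma dot_increment_ge n (w : 'rV[R]_n) (x : R -> 'rV[R]_n) (T t0 c : R) :
  abs_continuous 0 T x -> 0 <= t0 -> t0 <= T ->
  {ae mu, forall t, t \in `]0, t0[ ->
    derivable x t 1 /\ c <= dot w (derive1 x t)} ->
  c * t0 <= dot w (x t0) - dot w (x 0).
Proof.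
move=> acx t0_ge0 t0T dx; rewrite -{1}(subr0 t0).
apply: (@ac_slope_le (fun t => dot w (x t))) => //.
  exact: dot_scalar_ac acx.
apply: ae_impl dx => t /[apply] -[dxt ct].
by have [? ->] := derive1_dot w dxt.
Qed.

End DerivativeBounds.

(* Unconditional sums have bounded absolute sums *)
#[local] Existing Instance summability.totally_filter.

Section UnconditionalSum.
Context {R : realType} {I : choiceType}.
Implicit Types (x : I -> R) (A C : {fset I}).

Lemma partial_sumE x A :
  summability.partial_sum x A = \sum_(i <- A) x i.
Proof. by rewrite /summability.partial_sum big_seq_fsetE. Qed.

Lemma near_totally A :
  \forall B \near @summability.totally I, (A `<=` B)%fset.
Proof. by exists A. Qed.

Lemma sum_fsetU_disjoint x A C : {in C, forall i, i \notin A} ->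
  \sum_(i <- (A `|` C)%fset) x i = \sum_(i <- A) x i + \sum_(i <- C) x i.
Proof.
move=> CA; rewrite (big_fsetID _ (mem A)) /=; congr (_ + _).
  apply: eq_fbigl => i; rewrite !inE /=.
  by case: (i \in A); rewrite ?andbF.
apply: eq_fbigl => i; rewrite !inE /=.
by have [/CA/negPf ->|_] := boolP (i \in C); rewrite ?orbT ?orbF ?andbN.
Qed.

(** Partial sums over finite sets containing some fixed [A] are within 1 of the limit, so every
    finite sum avoiding [A] is below 2 in absolute value. Terms of constant sign turn such a bound
    into one on absolute values. *)
Lemma cvg_partial_sum_bounded x (l : R) :
  summability.partial_sum x @ summability.totally --> l ->
  exists M : R, forall C, \sum_(i <- C) `|x i| <= M.
Proof.
move=> /cvgrPdist_lt /(_ 1 ltr01)[A _ xA].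
have small C : {in C, forall i, i \notin A} -> `|\sum_(i <- C) x i| < 2.
  move=> CA; have := xA _ (fsubset_refl A); have := xA _ (fsubsetUl A C).
  rewrite !partial_sumE (sum_fsetU_disjoint _ CA) !ltr_norml.
  set a := \sum_(i <- A) _; set c := \sum_(i <- C) _; lra.
(* Outside [A], the nonnegative and the negative terms cost at most 2 each. *)
exists (\sum_(i <- A) `|x i| + 4) => C.
rewrite (big_fsetID _ (mem A)) /=; apply: lerD.
  rewrite [leRHS](big_fsetID _ (mem C)) /= -[leLHS]addr0.
  apply: lerD; last by apply: sumr_ge0.
  by rewrite le_eqVlt; apply/orP; left; apply/eqP/eq_fbigl => i; rewrite !inE andbC.
set D := [fset i in C | i \notin A]%fset.
have DA (P : pred I) : {in [fset i in D | P i]%fset, forall i, i \notin A}.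
  by move=> i; rewrite !inE => /andP[/andP[_]].
rewrite (big_fsetID _ (fun i => 0 <= x i)) /=.
have := small _ (DA (fun i => 0 <= x i)).
have := small _ (DA (fun i => ~~ (0 <= x i))).
have -> : \sum_(i <- [fset i in D | 0 <= x i]%fset) `|x i| =
    \sum_(i <- [fset i in D | 0 <= x i]%fset) x i.
  rewrite [LHS]big_seq [RHS]big_seq; apply: eq_bigr => i; rewrite !inE => /andP[_].
  exact: ger0_norm.
have -> : \sum_(i <- [fset i in D | ~~ (0 <= x i)]%fset) `|x i| =
    - \sum_(i <- [fset i in D | ~~ (0 <= x i)]%fset) x i.
  rewrite -sumrN [LHS]big_seq [RHS]big_seq; apply: eq_bigr => i.
  by rewrite !inE -ltNge => /andP[_ /ltr0_norm].
rewrite !ltr_norml; set a := \sum_(i <- _) _; set c := \sum_(i <- _) _; lra.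
Qed.

End UnconditionalSum.

(** * Continuity of analytic maps *)

Section AnalyticContinuous.
Context {R : realType} {n : nat}.
Implicit Types (h : 'rV[R]_n) (a : {ffun 'I_n -> nat}).

(** A nonconstant monomial has some positive exponent, which supplies one factor [theta]; the
    remaining powers of [theta] are at most 1. *)
Lemma monomial_le h (s theta : R) a :
  0 <= s -> 0 <= theta <= 1 -> (forall i, `|h 0 i| <= theta * s) ->
  a != [ffun => 0%N] ->
  `|monomial a h| <= theta * monomial a (const_mx s).
Proof.
move=> s0 /andP[th0 th1] hs a0.
have [i0 ai0] : exists i, a i != 0%N.
  apply/existsP; apply: contra_neqT a0 => /existsPn a0.
  by apply/ffunP => i; rewrite ffunE; apply/eqP; have := a0 i; rewrite negbK.
rewrite /monomial normr_prod.
apply: (@le_trans _ _ (\prod_(i < n) (theta ^+ a i * s ^+ a i))).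
  apply: ler_prod => i _; rewrite normr_ge0 /= normrX -exprMn.
  by rewrite lerXn2r ?nnegrE ?mulr_ge0.
rewrite big_split /=.
under [in leRHS]eq_bigr do rewrite mxE.
rewrite ler_wpM2r//; first by apply: prodr_ge0 => i _; rewrite exprn_ge0.
rewrite (bigD1 i0)//= -[leRHS]mulr1 ler_pM ?exprn_ge0//.
- by apply: prodr_ge0 => i _; rewrite exprn_ge0.
- by case: (a i0) ai0 => // k _; rewrite exprS ler_piMr// exprn_ile1.
- by apply: prodr_ile1 => i _; rewrite exprn_ge0//= exprn_ile1.
Qed.

(* Convergence at x0 + (s,...,s) bounds the sums of |c_a| s^|a|; shrinking the
   argument by theta gains a factor theta in every term but the constant one. *)
Lemma analytic_lipschitz_at (f : 'rV[R]_n -> R) (x0 : 'rV[R]_n) (r : R)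
    (c : {ffun 'I_n -> nat} -> R) :
  0 < r ->
  (forall x, eball x0 r x ->
    summability.partial_sum (fun a => c a * monomial a (x - x0))
      @ summability.totally --> f x) ->
  exists (L s : R), 0 < s /\
    forall x, eball x0 s x -> `|f x - f x0| <= L * enorm (x - x0).
Proof.
move=> r0 fc.
(* The corner [x0 + const_mx s] is at distance sqrt(n) s from [x0]; dividing [r] by n + 1 puts it
   strictly inside the ball, also for n = 0. *)
have [s s0 rs] : exists2 s, 0 < s & r = n.+1%:R * s.
  by exists (r / n.+1%:R); [rewrite divr_gt0|rewrite mulrC divfK].
have sr : s <= r by rewrite rs ler_peMl ?ler1n ?(ltW s0).
have xsK : x0 + const_mx s - x0 = const_mx s by rewrite addrAC subrr add0r.
have /fc : eball x0 r (x0 + const_mx s).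
  rewrite /eball /= xsK -ltr_sqr ?nnegrE ?enorm_ge0 ?ltW// sqr_enorm.
  rewrite /dot (eq_bigr (fun=> s ^+ 2)); last by move=> i _; rewrite !mxE.
  rewrite sumr_const card_ord -mulr_natl rs exprMn ltr_pM2r ?exprn_gt0//.
  by rewrite -natrX ltr_nat (leq_trans (ltnSn n))// leq_pmulr.
rewrite xsK => /cvg_partial_sum_bounded[M cM].
pose a0 : {ffun 'I_n -> nat} := [ffun => 0%N].
have mono0 h : monomial a0 h = 1.
  by rewrite /monomial big1// => i _; rewrite ffunE expr0.
(* Finite partial sums containing the constant term differ from it by at most [theta] times an
   absolute sum at the corner, hence by at most [theta * M]. At [x0] this is used with
   [theta = 0]. *)
have near_c0 x theta : eball x0 r x -> 0 <= theta <= 1 ->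
    (forall i, `|(x - x0) 0 i| <= theta * s) -> `|f x - c a0| <= theta * M.
  move=> xr th01 xs; apply/ler_addgt0Pr => e e0.
  have /cvgrPdist_lt/(_ e e0) fe := fc x xr.
  have [B [Be aB]] := filter_ex (filterI fe (near_totally [fset a0]%fset)).
  rewrite fsub1set in aB.
  have : `|\sum_(a <- B) c a * monomial a (x - x0) - c a0| <= theta * M.
    rewrite (big_fsetD1 a0)//= mono0 mulr1 addrAC subrr add0r.
    rewrite (le_trans (ler_norm_sum _ _ _))//.
    apply: (@le_trans _ _ (\sum_(a <- (B `\ a0)%fset)
        theta * `|c a * monomial a (const_mx s)|)); last first.
      rewrite -mulr_sumr ler_wpM2l//; first by case/andP: th01.
    rewrite big_seq [leRHS]big_seq; apply: ler_sum => a.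
    rewrite !inE => /andP[aa0 _].
    rewrite !normrM mulrCA ler_wpM2l//.
    rewrite (le_trans (monomial_le (ltW s0) th01 xs aa0))//.
    by rewrite ler_wpM2l ?ler_norm//; case/andP: th01.
  move: Be; rewrite partial_sumE.
  set S := \sum_(a <- B) _ => Be SM.
  rewrite -(subrKA S) (le_trans (ler_normD _ _))// addrC.
  by apply: lerD => //; exact: ltW.
have fx0 : f x0 = c a0.
  apply/eqP; rewrite -subr_eq0 -normr_le0 -(mul0r M); apply: near_c0.
  - by rewrite /eball /= subrr enorm0.
  - by rewrite lexx ler01.
  - by move=> i; rewrite subrr mxE normr0 mul0r.
(* Here [theta] is [enorm (x - x0) / s], whence the constant [M / s]. *)
exists (M / s), s; split => // x xs; rewrite fx0 mulrAC -mulrA mulrC.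
apply: near_c0.
- exact: lt_le_trans sr.
- by rewrite divr_ge0 ?enorm_ge0 ?(ltW s0)//= ler_pdivrMr// mul1r ltW.
- by move=> i; rewrite divfK ?gt_eqF// coord_le_enorm.
Qed.

Lemma analytic_continuous p (f : 'rV[R]_n -> 'rV[R]_p) :
  analytic f -> continuous f.
Proof.
move=> af x0; apply/(@cvgrPdist_lt _ _ _ _ (nbhs_filter x0)) => e e0.
have : \forall x \near x0, forall j, `|f x0 0 j - f x 0 j| < e.
  apply: (@filter_forall _ _ _ (nbhs x0) (nbhs_filter x0)) => j.
  have [r [c [r0 fc]]] := af j x0.
  have [L [s [s0 fL]]] := analytic_lipschitz_at r0 fc.
  pose d := Num.min s (e / (`|L| + 1)).
  have L1 : 0 < `|L| + 1 by rewrite ltr_pwDr.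
  have d0 : 0 < d by rewrite lt_min s0 divr_gt0.
  apply: filterS (nbhs_eball x0 d0) => x.
  rewrite /eball /= lt_min => /andP[xs xe].
  rewrite distrC (le_lt_trans (fL x xs))//.
  move: xe; rewrite ltr_pdivlMr//; apply: le_lt_trans.
  rewrite mulrC ler_wpM2l ?enorm_ge0//.
  by rewrite (le_trans (ler_norm L))// lerDl.
apply: filterS => x fx; rewrite /Num.Def.normr/= mx_normrE.
by apply: bigmax_lt => // -[i j] _; rewrite ord1 !mxE.
Qed.

End AnalyticContinuous.

Lemma of_class_continuous (R : realType) (n p : nat) (nu : smoothness)
    (f : 'rV[R]_n -> 'rV[R]_p) : of_class nu f -> continuous f.
Proof.
case: nu => [[|k] _||] /=; [by case|by case| |exact: analytic_continuous].
by move=> /(_ 0%N)[].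
Qed.

(** * Elements of minimal norm: existence, first-order condition, uniqueness *)

Section MinimalNorm.
Context {R : realType} {n : nat}.
Implicit Types (A : set 'rV[R]_n) (v w : 'rV[R]_n).

Lemma min_norm_elt_exists A :
  A !=set0 -> compact A -> exists v, min_norm_elt A v.
Proof.
move=> A0 cA.
have [|v vA vmin] := EVT_min_rV (f := enorm) A0 cA.
  by apply: continuous_subspaceT; exact: enorm_continuous.
exists v; split; first by move: vA; rewrite inE.
by move=> w Aw; apply: vmin; rewrite inE.
Qed.

(** Convexity with plain real coefficients, convenient for computation; [segment_closed_convex]
    passes to [convex_set]. *)
Definition segment_closed A : Prop := forall v w (t : R),
  A v -> A w -> 0 <= t <= 1 -> A (t *: v + (1 - t) *: w).

(** First-order condition: if <v,w> < <v,v>, a small move from [v] towards [w] would shorten [v]. *)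
Lemma min_norm_elt_dot A v w :
  segment_closed A -> min_norm_elt A v -> A w -> dot v v <= dot v w.
Proof.
move=> cA [Av vmin] Aw; rewrite leNgt; apply/negP => vw.
pose D := dot (w - v) (w - v); pose c := dot v v - dot v w.
have c0 : 0 < c by rewrite subr_gt0.
have D0 : 0 <= D by exact: dotxx_ge0.
(* At parameter t the square norm is <v,v> - 2tc + t^2 D. This choice keeps t <= 1 and gives t^2 D =
   tc - t^2 c, so the norm strictly decreases. *)
pose t := c / (D + c).
have Dc : 0 < D + c by rewrite ltr_wpDl.
have t0 : 0 < t by exact: divr_gt0.
have t1 : t <= 1 by rewrite ler_pdivrMr// mul1r lerDr.
have tD : t * (D + c) = c by rewrite divfK ?gt_eqF.
have : dot v v <= dot (t *: w + (1 - t) *: v) (t *: w + (1 - t) *: v).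
  rewrite -!sqr_enorm ler_sqr ?nnegrE ?enorm_ge0//.
  by apply: vmin; apply: cA => //; rewrite ltW.
have -> : t *: w + (1 - t) *: v = v + t *: (w - v).
  by rewrite scalerBl scale1r scalerBr addrCA.
rewrite dotDl !dotDr !dotZl !dotZr (dotC (w - v) v) -/D.
have -> : dot v (w - v) = - c by rewrite dotBr /c opprB.
have tt : t * (t * D) = t * c - t * t * c.
  have -> : t * D = c - t * c by have := tD; lra.
  by rewrite mulrBr mulrA.
have : 0 < t * c by exact: mulr_gt0.
have : 0 < t * t * c by exact: mulr_gt0 (mulr_gt0 t0 t0) c0.
lra.
Qed.

(** The first-order conditions at [v] and at [w] add up to |v - w|^2 <= 0. *)
Lemma min_norm_elt_unique A v w :
  segment_closed A -> min_norm_elt A v -> min_norm_elt A w -> v = w.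
Proof.
move=> cA mv mw; apply/eqP; rewrite -subr_eq0 -dotxx_eq0.
rewrite eq_le dotxx_ge0 andbT dotBl !dotBr (dotC w v).
have := min_norm_elt_dot cA mv mw.1; have := min_norm_elt_dot cA mw mv.1.
rewrite (dotC w v); lra.
Qed.

Lemma segment_closed_convex A : segment_closed A -> convex_set A.
Proof.
move=> cA v w t; rewrite !inE => Av Aw.
have t01 : 0 <= t%:num <= 1 by rewrite ge0 le1.
exact: (cA v w t%:num Av Aw t01).
Qed.

End MinimalNorm.

(** * Velocity sets of a box system and bounds continuous in the state *)

Section BoxSystem.
Context {R : realType} {n m : nat} (F : box_system R n m).
Implicit Types (x v w : 'rV[R]_n) (u : 'rV[R]_m).

Lemma segment_closed_velocities x : segment_closed (feasible_velocities F x).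
Proof.
move=> _ _ t [u Ou <-] [v Ov <-] /andP[t0 t1].
exists (t *: u + (1 - t) *: v).
  move=> i; rewrite !mxE; have /andP[lu uh] := Ou i; have /andP[lv vh] := Ov i.
  have t1' : 0 <= 1 - t by rewrite subr_ge0.
  have := ler_wpM2l t0 lu; have := ler_wpM2l t0 uh.
  have := ler_wpM2l t1' lv; have := ler_wpM2l t1' vh.
  by move=> *; apply/andP; split; lra.
rewrite /velocity !scalerDr !scaler_sumr addrACA -scalerDl addrC subrKC scale1r.
rewrite addrC; congr (_ + _); rewrite -big_split; apply: eq_bigr => i _ /=.
by rewrite !mxE !scalerA -scalerDl.
Qed.

Lemma continuous_velocity x : continuous (velocity F x).
Proof.
move=> u; apply: (@cvgD _ _ _ (nbhs u)); first exact: cvg_cst.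
apply: (@cvg_big _ _ _ _ _ add_continuous _ (nbhs u)) => i _.
apply: (@cvgZr_tmp _ _ _ (nbhs u)); exact: coord_continuous.
Qed.

Lemma compact_velocities x : compact (feasible_velocities F x).
Proof.
apply: continuous_compact.
  by apply: continuous_subspaceT; exact: continuous_velocity.
have := @rV_compact R m (fun i => `[ulo F i x, uhi F i x]%classic).
rewrite /Omega /= => /(_ (fun i => @segment_compact _ _ _)).
by under eq_fun do (under eq_forall do rewrite in_itv /=).
Qed.

Lemma dot_velocity w x u :
  dot w (velocity F x u) =
  dot w (drift F x) + \sum_(i < m) u 0 i * dot w (ctrl F i x).
Proof.
by rewrite /velocity dotDr dot_sumr; under eq_bigr do rewrite dotZr.
Qed.

(** This is the minimum of <w, .> over V(x): a function affine in the controls splits over the box,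
    and each coordinate is minimised at an endpoint. The closed form makes continuity in [x]
    direct. *)
Definition min_rate w x : R :=
  dot w (drift F x) +
  \sum_(i < m) Num.min (ulo F i x * dot w (ctrl F i x))
                       (uhi F i x * dot w (ctrl F i x)).

Lemma min_rate_le w x v :
  feasible_velocities F x v -> min_rate w x <= dot w v.
Proof.
move=> [u Ou <-]; rewrite dot_velocity lerD2l; apply: ler_sum => i _.
have /andP[lu uh] := Ou i; rewrite ge_min; apply/orP.
have [d0|d0] := leP 0 (dot w (ctrl F i x)).
  by left; rewrite ler_wpM2r.
by right; rewrite ler_wnM2r// ltW.
Qed.

Lemma min_rate_attained w x :
  (forall i, ulo F i x <= uhi F i x) ->
  exists2 v, feasible_velocities F x v & dot w v = min_rate w x.
Proof.
move=> lh; pose u : 'rV[R]_m := \row_i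
  if ulo F i x * dot w (ctrl F i x) < uhi F i x * dot w (ctrl F i x)
  then ulo F i x else uhi F i x.
exists (velocity F x u).
  by exists u => // i; rewrite mxE; case: ifP; rewrite lexx lh.
rewrite dot_velocity; congr (_ + _); apply: eq_bigr => i _.
by rewrite mxE /Num.min; case: ifP.
Qed.

(** An upper bound for the speed rather than its supremum, chosen to be visibly continuous in
    [x]. *)
Definition max_speed x : R :=
  enorm (drift F x) +
  \sum_(i < m) (`|ulo F i x| + `|uhi F i x|) * enorm (ctrl F i x).

Lemma enorm_le_max_speed x v :
  feasible_velocities F x v -> enorm v <= max_speed x.
Proof.
move=> [u Ou <-]; rewrite (le_trans (enormD _ _))// lerD2l.
rewrite (le_trans (enorm_sum _ _ _))//; apply: ler_sum => i _.
rewrite enormZ ler_wpM2r ?enorm_ge0//.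
have /andP[lu uh] := Ou i.
have := ler_norm (- ulo F i x); have := ler_norm (uhi F i x).
have := normr_ge0 (ulo F i x); have := normr_ge0 (uhi F i x).
by rewrite normrN ler_norml => *; apply/andP; split; lra.
Qed.

Hypothesis drift_cont : continuous (drift F).
Hypothesis ctrl_cont : forall i, continuous (ctrl F i).
Hypothesis ulo_cont : forall i, continuous (ulo F i).
Hypothesis uhi_cont : forall i, continuous (uhi F i).

Lemma continuous_min_rate w : continuous (min_rate w).
Proof.
have dot_cont (f : 'rV[R]_n -> 'rV[R]_n) :
    continuous f -> continuous (fun x => dot w (f x)).
  by move=> cf x; apply: (@cvg_dot _ _ _ (nbhs x) (fun=> w)) (cvg_cst _) (cf x).
move=> x; apply: (@cvgD _ _ _ (nbhs x)); first exact: dot_cont.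
apply: (@cvg_big _ _ _ _ _ add_continuous _ (nbhs x)) => i _.
have dc := dot_cont _ (@ctrl_cont i) x.
apply: (continuous_min (f := fun y => ulo F i y * dot w (ctrl F i y))
  (g := fun y => uhi F i y * dot w (ctrl F i y))).
  exact: (@cvgM _ _ (nbhs x) _ _ _ _ _ (@ulo_cont i x) dc).
exact: (@cvgM _ _ (nbhs x) _ _ _ _ _ (@uhi_cont i x) dc).
Qed.

Lemma continuous_max_speed : continuous max_speed.
Proof.
have norm_cont (f : 'rV[R]_n -> 'rV[R]_n) :
    continuous f -> continuous (fun x => enorm (f x)).
  by move=> cf x; exact: (cvg_comp _ _ (cf x) (enorm_continuous (x := f x))).
move=> x; apply: (@cvgD _ _ _ (nbhs x)); first exact: norm_cont.
apply: (@cvg_big _ _ _ _ _ add_continuous _ (nbhs x)) => i _.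
apply: (@cvgM _ _ (nbhs x)); last exact: norm_cont.
by apply: (@cvgD _ _ _ (nbhs x)); apply: (@cvg_norm _ _ _ (nbhs x));
  [exact: ulo_cont|exact: uhi_cont].
Qed.

End BoxSystem.

(** * Growth along trajectories, exit times and unreachable points *)

Section Trajectories.
Context {R : realType} {n m : nat} (F : box_system R n m).
Implicit Types (w v y : 'rV[R]_n) (B : set 'rV[R]_n) (x : R -> 'rV[R]_n).

(** Both [w] and the sign of [c] are free: [lambda] with a positive rate yields the growth of Phi,
    and a displacement vector with a negative rate bounds how far a trajectory has moved. *)
Definition rate_ge B w (c : R) : Prop :=
  forall y v, B y -> feasible_velocities F y v -> c <= dot w v.

Lemma admissible_velocity T x : admissible F T x ->
  {ae lebesgue_measure, forall t : R, t \in `]0, T[ ->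
    derivable x t 1 /\ feasible_velocities F (x t) (derive1 x t)}.
Proof.
move=> [_ _ [u [_]]]; apply: ae_impl => t /[apply] -[Ou [dx vx]].
by split => //; rewrite derive1E vx; exists (u t).
Qed.

(** Membership in [B] is asked on the open time interval only, so that [t] may be a first exit
    time. *)
Lemma trajectory_increment B w c T t x : rate_ge B w c ->
  admissible F T x -> 0 <= t <= T ->
  (forall s, 0 < s < t -> B (x s)) ->
  dot w (x 0) + c * t <= dot w (x t).
Proof.
move=> Bc adm /andP[t0 tT] xB; have [_ acx _] := adm.
rewrite -lerBrDl; apply: (dot_increment_ge acx t0 tT).
apply: ae_impl (admissible_velocity adm) => s H st.
have sT : s \in `]0, T[.
  by move: st; rewrite !in_itv /= => /andP[-> /lt_le_trans /(_ tT) ->].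
have [dx vx] := H sT; split => //; apply: Bc vx; apply: xB.
by move: st; rewrite in_itv.
Qed.

Lemma abs_continuous_increment (a b : R) x (e : R) :
  abs_continuous a b x -> 0 < e ->
  exists2 d : R, 0 < d & forall s t, a <= s -> s <= t -> t <= b -> t - s < d ->
    enorm (x t - x s) < e.
Proof.
move=> acx e0; have [d d0 xd] := acx e e0; exists d => // s t as_ st tb std.
have := xd 1%N (fun=> s) (fun=> t); rewrite !big_ord1; apply => //.
by move=> i j _ _ _; rewrite (ord1 i) (ord1 j).
Qed.

(** Let [t0] be the infimum of the times spent outside. Up to [t0] the displacement is at most
    [M * T < rho], and continuity keeps the trajectory inside shortly afterwards, a
    contradiction. *)
Lemma short_time_stays_in (x_e : 'rV[R]_n) (rho M T : R) x :
  (forall y v, eball x_e rho y -> feasible_velocities F y v -> enorm v <= M) ->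
  0 <= M -> M * T < rho -> admissible F T x -> x 0 = x_e ->
  stays_in T x (eball x_e rho).
Proof.
move=> speed M0 MT adm x0 t1; rewrite in_itv /= => /andP[t1_ge0 t1T].
have [T0 acx _] := adm.
apply: contrapT => out1.
pose S := [set t | 0 <= t <= T /\ ~ eball x_e rho (x t)].
have St1 : S t1 by split => //; rewrite t1_ge0.
have lbS : has_lbound S by exists 0 => t [/andP[]].
set t0 := inf S.
have t0_ge0 : 0 <= t0 by apply: lb_le_inf; [exists t1|move=> t [/andP[]]].
have t0T : t0 <= T by apply: le_trans t1T; exact: ge_inf.
have before s : 0 < s < t0 -> eball x_e rho (x s).
  move=> /andP[s0 st0]; apply: contrapT => outs.
  have : S s by split => //; rewrite ltW//= (le_trans _ t0T)// ltW.
  by move/(ge_inf lbS); rewrite leNgt st0.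
have near_t0 : enorm (x t0 - x_e) <= M * T.
  (* Testing the motion against its own displacement gives |w|^2 <= M |w| t0, then |w| is
     cancelled. *)
  pose w := x_e - x t0.
  have rate : rate_ge (eball x_e rho) w (- (M * enorm w)).
    move=> y v yB Vv; rewrite lerNl -dotNl.
    rewrite (le_trans (cauchy_schwarz _ _))// enormN mulrC.
    by rewrite ler_wpM2r ?enorm_ge0//; exact: speed yB Vv.
  have t0T' : 0 <= t0 <= T by rewrite t0_ge0.
  have := trajectory_increment rate adm t0T' before.
  rewrite x0 mulNr lerBlDr -lerBlDl -dotBr -sqr_enorm => H.
  rewrite enormB -/w; have [->|w0] := eqVneq (enorm w) 0.
    by rewrite mulr_ge0// ltW.
  have wpos : 0 < enorm w by rewrite lt0r w0 enorm_ge0.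
  rewrite -(ler_pM2r wpos) -expr2 (le_trans H)// mulrAC ler_wpM2r ?enorm_ge0//.
  by rewrite ler_wpM2l.
(* An outside time within [d] of [t0] exists by the infimum, yet there the curve has moved less than
   this margin since [t0]. *)
have eps0 : 0 < rho - M * T by rewrite subr_gt0.
have [d d0 xd] := abs_continuous_increment acx eps0.
have [|t [/andP[t_ge0 tT] outt] tt0] := inf_adherent d0 (E := S).
  by split => //; exists t1.
have t0t : t0 <= t by apply: ge_inf => //; split => //; rewrite t_ge0.
apply: outt; rewrite /eball /= -(subrKA (x t0)).
have := xd t0 t t0_ge0 t0t tT; rewrite -/t0 in tt0.
have -> : t - t0 < d by rewrite ltrBlDl.
move=> /(_ isT) H; rewrite (le_lt_trans (enormD _ _))//; lra.
Qed.

(** The neighbourhood in [STLC] may exceed the ball where the rate bound holds, so the time horizon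
    is taken too short for leaving that ball. *)
Lemma not_STLC_of_rate_ge (x_e w : 'rV[R]_n) (rho M a : R) :
  0 < rho -> w != 0 -> 0 <= a -> rate_ge (eball x_e rho) w a ->
  (forall y v, eball x_e rho y -> feasible_velocities F y v -> enorm v <= M) ->
  ~ STLC F x_e.
Proof.
move=> rho0 w0 a0 rate speed [N [_ _ stlc]].
have M1 : 0 < `|M| + 1 by rewrite ltr_pwDr.
(* At speed at most |M| + 1, the distance covered in time [e] is at most [rho / 2]. *)
pose e := rho / 2 / (`|M| + 1).
have e0 : 0 < e by rewrite !divr_gt0.
have [r r0 ballr] := stlc e e0.
have w1 : 0 < enorm w by rewrite enorm_gt0.
(* The target lies at distance [r / 2] from [x_e], against the direction [w]. *)
pose y := x_e - (r / 2 / enorm w) *: w.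
have k0 : 0 < r / 2 / enorm w by rewrite !divr_gt0.
have yb : eball x_e r y.
  rewrite /eball /y /= addrAC subrr add0r enormN enormZ gtr0_norm//.
  by rewrite divfK ?gt_eqF//; lra.
have wy : dot w y < dot w x_e.
  rewrite /y dotBr dotZr -sqr_enorm gtrBl.
  by rewrite mulr_gt0// exprn_gt0.
case: (ballr y yb) => [/= yE|[tau [x [/andP[tau0 taue] adm _ x0 xtau]]]].
  by move: wy; rewrite yE ltxx.
have stay : stays_in tau x (eball x_e rho).
  apply: (@short_time_stays_in _ _ (`|M| + 1)) adm x0.
  - move=> z v zB Vv; rewrite (le_trans (speed z v zB Vv))//.
    by rewrite (le_trans (ler_norm M))// lerDl.
  - exact: ltW.
  - rewrite (@le_lt_trans _ _ ((`|M| + 1) * e))//; first by rewrite ler_wpM2l// ltW.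
    by rewrite /e mulrC divfK ?gt_eqF//; lra.
have tt : 0 <= tau <= tau by rewrite lexx ltW.
have stay' s : 0 < s < tau -> eball x_e rho (x s).
  by move=> /andP[s0 st]; apply: stay; rewrite in_itv /= !ltW.
have := trajectory_increment rate adm tt stay'.
rewrite x0 xtau => inc; have := le_lt_trans inc wy.
by rewrite gtrDl ltNge mulr_ge0// ltW.
Qed.

End Trajectories.

(** * Growth of Phi and failure of STLC when no admissible control balances the drift *)

Theorem theorem1 (R : realType) (n m : nat) (nu : smoothness)
  (F : box_system R n m) (x_e : 'rV[R]_n)
  (drift_smooth : of_class nu (drift F))
  (ctrl_smooth : forall i, of_class nu (ctrl F i))
  (ulo_cont : forall i, continuous (ulo F i))
  (uhi_cont : forall i, continuous (uhi F i))
  (ulo_lt_uhi : forall x i, ulo F i x < uhi F i x)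
  (zero_excluded : (forall x i, 0 < ulo F i x) \/ (forall x i, uhi F i x < 0)) :
  (balancing_set F x_e = set0 <-> ~ feasible_velocities F x_e 0) /\
  (balancing_set F x_e = set0 ->
   [/\ compact (feasible_velocities F x_e),
       convex_set (feasible_velocities F x_e),
       exists! v, min_norm_elt (feasible_velocities F x_e) v,
       forall v_star, min_norm_elt (feasible_velocities F x_e) v_star ->
         let alpha := enorm v_star in
         let lambda : 'rV[R]_n := (enorm v_star)^-1 *: v_star in
         let Phi := fun x : 'rV[R]_n => dot lambda x in
         let good := fun rho alpha' : R =>
           [/\ 0 < rho, 0 < alpha' <= alpha &
               forall x, eball x_e rho x ->
                 alpha' <= inf [set dot lambda v | v in feasible_velocities F x]] in
         [/\ 0 < alpha,
             exists rho alpha', good rho alpha' &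
             forall rho alpha', good rho alpha' ->
             [/\ forall T x, admissible F T x -> stays_in T x (eball x_e rho) ->
                   {ae lebesgue_measure, forall t : R, t \in `]0, T[ ->
                      [/\ derivable x t 1, derivable (Phi \o x) t 1,
                          derive1 (Phi \o x) t = dot lambda (derive1 x t) &
                          alpha' <= dot lambda (derive1 x t)]},
                 forall T x, admissible F T x ->
                   forall t : R, t \in `[0, T] -> stays_in t x (eball x_e rho) ->
                     Phi (x 0) + alpha' * t <= Phi (x t) &
                 forall y, Phi y < Phi x_e ->
                   ~ exists (T : R) (x : R -> 'rV[R]_n),
                       [/\ admissible F T x, stays_in T x (eball x_e rho),
                           x 0 = x_e & x T = y]]] &
       ~ STLC F x_e]).
Proof.
have cdrift := of_class_continuous drift_smooth.
have cctrl i := of_class_continuous (@ctrl_smooth i).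
split.
  split=> [B0 [u Ou u0]|V0].
    by have : balancing_set F x_e u by []; rewrite B0.
  by rewrite -subset0 => u [Ou u0]; apply: V0; exists u.
move=> B0.
have V0 : ~ feasible_velocities F x_e 0.
  by move=> [u Ou u0]; have : balancing_set F x_e u by []; rewrite B0.
have ulo_le x i : ulo F i x <= uhi F i x by exact: ltW.
have seg x : segment_closed (feasible_velocities F x).
  exact: segment_closed_velocities.
have cptV : compact (feasible_velocities F x_e) by exact: compact_velocities.
have Vne x : feasible_velocities F x !=set0.
  by have [v Vv _] := min_rate_attained 0 (ulo_le x); exists v.
have [v0 minv0] := min_norm_elt_exists (Vne x_e) cptV.
have v_neq0 v : min_norm_elt (feasible_velocities F x_e) v -> v != 0.
  by move=> [Vv _]; apply/eqP => vE; apply: V0; rewrite -vE.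
have rate_near v : min_norm_elt (feasible_velocities F x_e) v ->
    exists2 rho : R, 0 < rho & forall x, eball x_e rho x ->
      enorm v / 2 <= min_rate F ((enorm v)^-1 *: v) x.
  move=> minv; have v0' := v_neq0 v minv.
  have vpos : 0 < enorm v by rewrite enorm_gt0.
  apply: nbhs_eballP.
  (* The rate at [x_e] is at least [enorm v]; halving leaves the strict gap that continuity
     needs. *)
  have : enorm v / 2 < min_rate F ((enorm v)^-1 *: v) x_e.
    have [w Vw <-] := min_rate_attained ((enorm v)^-1 *: v) (ulo_le x_e).
    apply: (@lt_le_trans _ _ (enorm v)); first lra.
    rewrite dotZl mulrC ler_pdivlMr// -expr2 sqr_enorm.
    exact: min_norm_elt_dot (seg x_e) minv Vw.
  have := @continuous_min_rate _ _ _ F cdrift cctrl ulo_cont uhi_cont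
    ((enorm v)^-1 *: v) x_e.
  move=> /cvgr_gt H /H; apply: filterS => x; exact: ltW.
split.
- exact: cptV.
- exact: segment_closed_convex (seg x_e).
- exists v0; split => // v minv; exact: min_norm_elt_unique (seg x_e) minv0 minv.
- move=> v minv alpha lambda Phi good.
  have alpha0 : 0 < alpha by rewrite enorm_gt0; exact: v_neq0.
  split => //.
    have [rho rho0 rate] := rate_near v minv.
    exists rho, (alpha / 2); split => //; first by apply/andP; split; lra.
    move=> x /rate xr; apply: lb_le_inf.
      by have [w Vw] := Vne x; exists (dot lambda w), w.
    move=> _ [w Vw <-]; exact: le_trans xr (min_rate_le _ Vw).
  move=> rho a [rho0 /andP[a0 _] inf_ge].
  have rate : rate_ge F (eball x_e rho) lambda a.
    (* [inf] is a lower bound only of a set that is bounded below, here by [min_rate]. *)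
    move=> y w yB Vw; apply: le_trans (inf_ge y yB) _; apply: ge_inf.
      by exists (min_rate F lambda y) => _ [z Vz <-]; exact: min_rate_le.
    by exists w.
  have incr T x : admissible F T x -> forall t : R, t \in `[0, T] ->
      stays_in t x (eball x_e rho) -> Phi (x 0) + a * t <= Phi (x t).
    move=> adm t; rewrite in_itv /= => tT stay.
    apply: (trajectory_increment rate adm tT) => s /andP[s0 st].
    by apply: stay; rewrite in_itv /= !ltW.
  split => //.
    move=> T x adm stay; apply: ae_impl (admissible_velocity adm) => t H tT.
    have [dx vx] := H tT; have [dPhi PhiE] := derive1_dot lambda dx.
    split => //; apply: rate vx; apply: stay.
    by move: tT; rewrite !in_itv /= => /andP[? ?]; rewrite !ltW.
  move=> y yPhi [T [x [adm stay x0 xT]]].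
  have [T0 _ _] := adm.
  have := incr T x adm T _ stay; rewrite in_itv /= lexx ltW// x0 xT => /(_ isT).
  rewrite leNgt => /negP; apply.
  by rewrite (lt_le_trans yPhi)// lerDl mulr_ge0// ltW.
have [rho1 rho10 rate1] := rate_near v0 minv0.
have [rho2 rho20 speed] : exists2 rho : R, 0 < rho & forall x, eball x_e rho x ->
    max_speed F x <= max_speed F x_e + 1.
  apply: nbhs_eballP.
  have := @continuous_max_speed _ _ _ F cdrift cctrl ulo_cont uhi_cont x_e.
  move=> /cvgr_lt /(_ (max_speed F x_e + 1)); rewrite ltrDl => /(_ ltr01).
  by apply: filterS => x; exact: ltW.
pose rho := Num.min rho1 rho2.
have rhoP y : eball x_e rho y -> eball x_e rho1 y /\ eball x_e rho2 y.
  by rewrite /eball /= lt_min => /andP.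
have v0pos : 0 < enorm v0 by rewrite enorm_gt0; exact: v_neq0.
apply: (@not_STLC_of_rate_ge _ _ _ F x_e ((enorm v0)^-1 *: v0) rho
  (max_speed F x_e + 1) (enorm v0 / 2)).
- by rewrite lt_min rho10.
- by rewrite scaler_eq0 negb_or invr_eq0 gt_eqF//=; exact: v_neq0.
- by rewrite divr_ge0// ltW.
- move=> y w /rhoP[/rate1 yr _] Vw; exact: le_trans yr (min_rate_le _ Vw).
- move=> y w /rhoP[_ /speed yr] Vw; exact: le_trans (enorm_le_max_speed Vw) yr.
Qed.
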